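(* Let $P$ be an HCP term and $\Gamma$ an environment (a single one, not a hyper-environment with several components) such that $\vdash P:\Gamma$. Then either $P$ is in canonical form, or there exists an HCP term $Q$ with $P\Longrightarrow Q$.
   Context: Session types: $A,B ::= A\otimes B \mid \mathbf{1} \mid A ⅋ B \mid \bot \mid A\oplus B \mid \mathbf{0} \mid A \& B \mid \top$, with duality the involution $(A\otimes B)^\bot = A^\bot ⅋ B^\bot$, $(A ⅋ B)^\bot = A^\bot\otimes B^\bot$, $\mathbf{1}^\bot=\bot$, $\bot^\bot=\mathbf{1}$, $(A\oplus B)^\bot = A^\bot \& B^\bot$, $(A\& B)^\bot = A^\bot\oplus B^\bot$, $\mathbf{0}^\bot=\top$, $\top^\bot=\mathbf{0}$. An environment is a finite list $x_1:A_1,\dots,x_n:A_n$ of pairwise distinct names with types; $\Gamma,\Delta$ requires disjoint names. A hyper-environment is a finite multiset $\Gamma_1\mid\dots\mid\Gamma_n$ of environments (empty: $\varnothing$); names may be shared between its environments. HCP terms: $P,Q,R ::= x\leftrightarrow y \mid 0 \mid (\nu x)P$ (binds $x$) $\mid (P \mid Q) \mid x[y].P$ ($y$ bound in $P$) $\mid x(y).P$ ($y$ bound in $P$) $\mid x[].P \mid x().P \mid x\triangleleft \mathrm{inl}.P \mid x\triangleleft\mathrm{inr}.P \mid x\triangleright\{\mathrm{inl}:P;\mathrm{inr}:Q\} \mid x\triangleright\{\}$. HCP typing $\vdash P:\mathcal{G}$: (Ax) $\vdash x\leftrightarrow y : x:A, y:A^\bot$. (H-Cut) from $\vdash P:\mathcal{G}\mid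 \Gamma, x:A \mid \Delta, x:A^\bot$ infer $\vdash (\nu x)P : \mathcal{G}\mid \Gamma,\Delta$. (H-Mix) from $\vdash P:\mathcal{G}$, $\vdash Q:\mathcal{H}$ infer $\vdash (P\mid Q): \mathcal{G}\mid\mathcal{H}$. (H-Mix$_0$) $\vdash 0:\varnothing$. ($\otimes$) from $\vdash P : \mathcal{G}\mid \Gamma, y:A \mid \Delta, x:B$ infer $\vdash x[y].P : \mathcal{G}\mid\Gamma,\Delta,x:A\otimes B$. ($⅋$) from $\vdash P : \mathcal{G}\mid\Gamma, y:A, x:B$ infer $\vdash x(y).P : \mathcal{G}\mid\Gamma, x:A⅋B$. ($\mathbf{1}$) from $\vdash P:\mathcal{G}$ infer $\vdash x[].P : \mathcal{G}\mid x:\mathbf{1}$. ($\bot$) from $\vdash P:\mathcal{G}\mid\Gamma$ infer $\vdash x().P : \mathcal{G}\mid\Gamma,x:\bot$. ($\oplus_1$) from $\vdash P:\mathcal{G}\mid\Gamma,x:A$ infer $\vdash x\triangleleft\mathrm{inl}.P:\mathcal{G}\mid\Gamma,x:A\oplus B$; ($\oplus_2$) analogously with $\mathrm{inr}$ and $x:B$. ($\&$) from $\vdash P:\Gamma,x:A$ and $\vdash Q:\Gamma,x:B$ infer $\vdash x\triangleright\{\mathrm{inl}:P;\mathrm{inr}:Q\}:\Gamma,x:A\&B$. ($\top$) $\vdash x\triangleright\{\}:\Gamma,x:\top$. No rule for $\mathbf{0}$. Each logical rule ($\otimes,⅋,\mathbf{1},\bot,\oplus_1,\oplus_2$) has the side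 condition that $x$ does not occur in $\mathcal{G}$. HCP structural congruence $\equiv$: smallest congruence containing $x\leftrightarrow y\equiv y\leftrightarrow x$; $(P\mid 0)\equiv P$; $(P\mid Q)\equiv(Q\mid P)$; $(P\mid(Q\mid R))\equiv((P\mid Q)\mid R)$; $(\nu x)(\nu y)P\equiv(\nu y)(\nu x)P$; $(\nu x)(P\mid Q)\equiv (P\mid(\nu x)Q)$ if $x$ not free in $P$. HCP reduction $\Longrightarrow$: smallest relation closed under $(\nu x)(w\leftrightarrow x \mid P)\Longrightarrow P\{w/x\}$; $(\nu x)(x[y].P \mid x(y).R) \Longrightarrow (\nu x)(\nu y)(P\mid R)$; $(\nu x)(x[].P\mid x().Q)\Longrightarrow (P\mid Q)$; $(\nu x)(x\triangleleft\mathrm{inl}.P\mid x\triangleright\{\mathrm{inl}:Q;\mathrm{inr}:R\})\Longrightarrow(\nu x)(P\mid Q)$; $(\nu x)(x\triangleleft\mathrm{inr}.P\mid x\triangleright\{\mathrm{inl}:Q;\mathrm{inr}:R\})\Longrightarrow(\nu x)(P\mid R)$; if $P\Longrightarrow P'$ then $(\nu x)P\Longrightarrow(\nu x)P'$ and $(P\mid Q)\Longrightarrow(P'\mid Q)$; if $P\equiv Q\Longrightarrow Q'\equiv P'$ then $P\Longrightarrow P'$. A process acts on $x$ if $x$ is free in its outermost term constructor (e.g. $x[y].P$ acts on $x$ but not $y$; $x\leftrightarrow y$ acts on both $x$ and $y$). A process $P$ is in canonical form if $P\equiv(\nu x_1)\dots(\nu x_n)(P_1\mid\dots\mid P_{n+m+1})$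 for some $n,m\ge 0$ such that: no $P_i$ is a restriction or a parallel composition; no $P_i$ is a link acting on one of the bound channels $x_j$; and no two distinct $P_i,P_j$ act on the same bound channel $x_k$.
   Formalization: In H-Cut the cut name x is required not to occur in the remaining hyper-environment G; without this, (νv)(νx)(x[].0 | x().v[].0 | v().x[].0) would be typed x:1 yet be neither canonical nor reducible. *)

(* Defs.v *)
From HB Require Import structures.
From mathcomp Require Import all_boot.

Set Implicit Arguments.
Unset Strict Implicit.
Unset Printing Implicit Defensive.

Definition name := nat.

Inductive ty : Type :=
| Tens of ty & ty | One
| Parr of ty & ty | Bot
| Plus of ty & ty | Zero
| With of ty & ty | Top.

Lemma ty_eq_dec (A B : ty) : {A = B} + {A <> B}.
Proof. decide equality. Defined.

HB.instance Definition _ := hasDecEq.Build ty (compareP ty_eq_dec).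

Fixpoint dual (A : ty) : ty :=
  match A with
  | Tens A B => Parr (dual A) (dual B)
  | Parr A B => Tens (dual A) (dual B)
  | One => Bot
  | Bot => One
  | Plus A B => With (dual A) (dual B)
  | With A B => Plus (dual A) (dual B)
  | Zero => Top
  | Top => Zero
  end.

(* Terms are taken up to alpha-equivalence, through a locally nameless
   representation: a bound channel is a de Bruijn index, a free one a name.
   In [ROut c P] (that is, c[y].P) and [RIn c P] (that is, c(y).P) the object
   y is bound in P only, so the subject c lies outside the scope of the
   binder. *)
Inductive chan : Type := BV of nat | FV of name.

Inductive raw : Type :=
| RLink of chan & chan
| RNil
| RNu of raw
| RPar of raw & raw
| ROut of chan & raw
| RIn of chan & raw
| RClose of chan & raw
| RWait of chan & raw
| RInl of chan & raw
| RInr of chan & raw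
| RCase of chan & raw & raw
| RAbsurd of chan.

Definition lc_chan (k : nat) (c : chan) : bool :=
  if c is BV i then i < k else true.

Fixpoint lc (k : nat) (P : raw) : bool :=
  match P with
  | RLink c d => lc_chan k c && lc_chan k d
  | RNil => true
  | RNu P => lc k.+1 P
  | RPar P Q => lc k P && lc k Q
  | ROut c P | RIn c P => lc_chan k c && lc k.+1 P
  | RClose c P | RWait c P | RInl c P | RInr c P => lc_chan k c && lc k P
  | RCase c P Q => [&& lc_chan k c, lc k P & lc k Q]
  | RAbsurd c => lc_chan k c
  end.

(* [abs k x P] turns the free name x of P into the de Bruijn index k. *)
Definition abs_chan (k : nat) (x : name) (c : chan) : chan :=
  if c is FV y then (if y == x then BV k else c) else c.

Fixpoint abs (k : nat) (x : name) (P : raw) : raw :=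
  match P with
  | RLink c d => RLink (abs_chan k x c) (abs_chan k x d)
  | RNil => RNil
  | RNu P => RNu (abs k.+1 x P)
  | RPar P Q => RPar (abs k x P) (abs k x Q)
  | ROut c P => ROut (abs_chan k x c) (abs k.+1 x P)
  | RIn c P => RIn (abs_chan k x c) (abs k.+1 x P)
  | RClose c P => RClose (abs_chan k x c) (abs k x P)
  | RWait c P => RWait (abs_chan k x c) (abs k x P)
  | RInl c P => RInl (abs_chan k x c) (abs k x P)
  | RInr c P => RInr (abs_chan k x c) (abs k x P)
  | RCase c P Q => RCase (abs_chan k x c) (abs k x P) (abs k x Q)
  | RAbsurd c => RAbsurd (abs_chan k x c)
  end.

Definition rsubst_chan (w x : name) (c : chan) : chan :=
  if c is FV y then (if y == x then FV w else c) else c.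

Fixpoint rsubst (w x : name) (P : raw) : raw :=
  match P with
  | RLink c d => RLink (rsubst_chan w x c) (rsubst_chan w x d)
  | RNil => RNil
  | RNu P => RNu (rsubst w x P)
  | RPar P Q => RPar (rsubst w x P) (rsubst w x Q)
  | ROut c P => ROut (rsubst_chan w x c) (rsubst w x P)
  | RIn c P => RIn (rsubst_chan w x c) (rsubst w x P)
  | RClose c P => RClose (rsubst_chan w x c) (rsubst w x P)
  | RWait c P => RWait (rsubst_chan w x c) (rsubst w x P)
  | RInl c P => RInl (rsubst_chan w x c) (rsubst w x P)
  | RInr c P => RInr (rsubst_chan w x c) (rsubst w x P)
  | RCase c P Q => RCase (rsubst_chan w x c) (rsubst w x P) (rsubst w x Q)
  | RAbsurd c => RAbsurd (rsubst_chan w x c)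
  end.

Definition chan_names (c : chan) : seq name := if c is FV x then [:: x] else [::].

Fixpoint rfn (P : raw) : seq name :=
  match P with
  | RLink c d => chan_names c ++ chan_names d
  | RNil => [::]
  | RNu P => rfn P
  | RPar P Q => rfn P ++ rfn Q
  | ROut c P | RIn c P | RClose c P | RWait c P | RInl c P | RInr c P =>
      chan_names c ++ rfn P
  | RCase c P Q => chan_names c ++ rfn P ++ rfn Q
  | RAbsurd c => chan_names c
  end.

Lemma lc_abs_chan k x c : lc_chan k c -> lc_chan k.+1 (abs_chan k x c).
Proof. by case: c => [i /ltnW|y] //= _; case: eqP => //=. Qed.

Lemma lc_abs k x P : lc k P -> lc k.+1 (abs k x P).
Proof.
elim: P k => [c d|//|P IH|P IHP Q IHQ|c P IH|c P IH|c P IH|c P IH|c P IH|c P IH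
             |c P IHP Q IHQ|c] k /=; rewrite -?andbA;
  by [apply: IH | apply: lc_abs_chan
     | case/andP=> *; rewrite ?lc_abs_chan ?IH ?IHP ?IHQ
     | case/and3P=> *; rewrite ?lc_abs_chan ?IHP ?IHQ].
Qed.

Lemma lc_rsubst_chan k w x c : lc_chan k c -> lc_chan k (rsubst_chan w x c).
Proof. by case: c => //= y _; case: eqP. Qed.

Lemma lc_rsubst k w x P : lc k P -> lc k (rsubst w x P).
Proof.
elim: P k => [c d|//|P IH|P IHP Q IHQ|c P IH|c P IH|c P IH|c P IH|c P IH|c P IH
             |c P IHP Q IHQ|c] k /=;
  by [apply: IH | apply: lc_rsubst_chan
     | case/andP=> *; rewrite ?lc_rsubst_chan ?IH ?IHP ?IHQ
     | case/and3P=> *; rewrite ?lc_rsubst_chan ?IHP ?IHQ].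
Qed.

Definition term : Type := {P : raw | lc 0 P}.

Lemma lc_and k P Q : lc k P -> lc k Q -> lc k P && lc k Q.
Proof. by move=> -> ->. Qed.

Definition link (x y : name) : term := exist (lc 0) (RLink (FV x) (FV y)) isT.
Definition inact : term := exist (lc 0) RNil isT.
Definition nu (x : name) (P : term) : term :=
  exist (lc 0) (RNu (abs 0 x (sval P))) (lc_abs x (svalP P)).
Definition par (P Q : term) : term :=
  exist (lc 0) (RPar (sval P) (sval Q)) (lc_and (svalP P) (svalP Q)).
Definition out (x y : name) (P : term) : term :=
  exist (lc 0) (ROut (FV x) (abs 0 y (sval P))) (lc_abs y (svalP P)).
Definition inp (x y : name) (P : term) : term :=
  exist (lc 0) (RIn (FV x) (abs 0 y (sval P))) (lc_abs y (svalP P)).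
Definition close (x : name) (P : term) : term :=
  exist (lc 0) (RClose (FV x) (sval P)) (svalP P).
Definition wait (x : name) (P : term) : term :=
  exist (lc 0) (RWait (FV x) (sval P)) (svalP P).
Definition sel_inl (x : name) (P : term) : term :=
  exist (lc 0) (RInl (FV x) (sval P)) (svalP P).
Definition sel_inr (x : name) (P : term) : term :=
  exist (lc 0) (RInr (FV x) (sval P)) (svalP P).
Definition offer (x : name) (P Q : term) : term :=
  exist (lc 0) (RCase (FV x) (sval P) (sval Q)) (lc_and (svalP P) (svalP Q)).
Definition absurd (x : name) : term := exist (lc 0) (RAbsurd (FV x)) isT.

Definition fn (P : term) : seq name := rfn (sval P).

(* P{w/x}; no capture is possible, as binders do not carry names. *)
Definition subst (w x : name) (P : term) : term :=
  exist (lc 0) (rsubst w x (sval P)) (lc_rsubst w x (svalP P)).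

Lemma abs_rsubst k x z P : z \notin rfn P -> abs k z (rsubst z x P) = abs k x P.
Proof.
have H c j : z \notin chan_names c ->
    abs_chan j z (rsubst_chan z x c) = abs_chan j x c.
  case: c => //= y; rewrite inE eq_sym.
  by case: (y =P x) => [_ _|_] /=; rewrite ?eqxx // => /negbTE->.
elim: P k => [c d|//|P IH|P IHP Q IHQ|c P IH|c P IH|c P IH|c P IH|c P IH|c P IH
             |c P IHP Q IHQ|c] k /=;
  rewrite ?mem_cat ?negb_or;
  by [move=> ?; rewrite ?H ?IH | case/andP=> *; rewrite ?H ?IH ?IHP ?IHQ
     | case/and3P=> *; rewrite ?H ?IHP ?IHQ].
Qed.

Lemma nu_alpha x z P : z \notin fn P -> nu z (subst z x P) = nu x P.
Proof. by move=> zP; apply: val_inj; rewrite /= abs_rsubst. Qed.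

(* Environments and hyper-environments are lists, identified up to [henv_eqv]:
   the order is irrelevant both inside an environment and between
   environments.  [[::]] is the empty hyper-environment, and [[:: [::]]] the
   hyper-environment with one empty component. *)
Definition env := seq (name * ty).
Definition henv := seq env.

Definition dom (Gam : env) : seq name := [seq p.1 | p <- Gam].
Definition names (G : henv) : seq name := flatten [seq dom Gam | Gam <- G].
Definition wf_env (Gam : env) : bool := uniq (dom Gam).

Definition henv_eqv (G H : henv) : Prop :=
  exists2 K : henv, perm_eq G K & all2 (fun Gam Del => perm_eq Gam Del) K H.

(* In [T_cut], the premise [x \notin names G] is the convention that a bound
   name differs from the names of the conclusion.  Names may be shared between
   the components of a hyper-environment, so without it the rule would also
   bind, in P, the x of a third component that is not being cut. *)
Inductive typed : term -> henv -> Prop :=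
| T_exch P G H :
    typed P G -> henv_eqv G H -> typed P H
| T_ax x y A :
    wf_env [:: (x, A); (y, dual A)] ->
    typed (link x y) [:: [:: (x, A); (y, dual A)]]
| T_cut P G Gam Del x A :
    typed P [:: (x, A) :: Gam, (x, dual A) :: Del & G] ->
    wf_env (Gam ++ Del) -> x \notin names G ->
    typed (nu x P) ((Gam ++ Del) :: G)
| T_mix P Q G H :
    typed P G -> typed Q H -> typed (par P Q) (G ++ H)
| T_mix0 :
    typed inact [::]
| T_tens P G Gam Del x y A B :
    typed P [:: (y, A) :: Gam, (x, B) :: Del & G] ->
    wf_env ((x, Tens A B) :: Gam ++ Del) -> x \notin names G ->
    typed (out x y P) (((x, Tens A B) :: Gam ++ Del) :: G)
| T_parr P G Gam x y A B :
    typed P (((y, A) :: (x, B) :: Gam) :: G) -> x \notin names G ->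
    typed (inp x y P) (((x, Parr A B) :: Gam) :: G)
| T_one P G x :
    typed P G -> x \notin names G ->
    typed (close x P) ([:: (x, One)] :: G)
| T_bot P G Gam x :
    typed P (Gam :: G) ->
    wf_env ((x, Bot) :: Gam) -> x \notin names G ->
    typed (wait x P) (((x, Bot) :: Gam) :: G)
| T_plus1 P G Gam x A B :
    typed P (((x, A) :: Gam) :: G) -> x \notin names G ->
    typed (sel_inl x P) (((x, Plus A B) :: Gam) :: G)
| T_plus2 P G Gam x A B :
    typed P (((x, B) :: Gam) :: G) -> x \notin names G ->
    typed (sel_inr x P) (((x, Plus A B) :: Gam) :: G)
| T_with P Q Gam x A B :
    typed P [:: (x, A) :: Gam] -> typed Q [:: (x, B) :: Gam] ->
    typed (offer x P Q) [:: (x, With A B) :: Gam]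
| T_top Gam x :
    wf_env ((x, Top) :: Gam) ->
    typed (absurd x) [:: (x, Top) :: Gam].

Lemma henv_eqv_wf G H : henv_eqv G H -> all wf_env G -> all wf_env H.
Proof.
case=> K /perm_all -> {G}; elim: K H => [|Gam K IH] [|Del H] //=.
case/andP=> GD KH /andP[Gwf Kwf]; rewrite (IH _ KH Kwf) andbT.
by rewrite /wf_env -(perm_uniq (perm_map _ GD)).
Qed.

Lemma typed_wf P G : typed P G -> all wf_env G.
Proof.
elim=> {P G} //=.
- by move=> P G H _ IH /henv_eqv_wf; apply.
- by move=> x y A ->.
- by move=> P G Gam Del x A _ /and3P[_ _ ->] ->.
- by move=> P Q G H _ IHP _ IHQ; rewrite all_cat IHP.
- by move=> P G Gam Del x y A B _ /and3P[_ _ ->] ->.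
- by move=> P G Gam x y A B _ /andP[/andP[_ +] ->] _; rewrite /wf_env /= => ->.
- by move=> P G Gam x _ /andP[_ ->] ->.
- by move=> Gam x ->.
Qed.

Inductive cong : term -> term -> Prop :=
| C_refl P : cong P P
| C_sym P Q : cong P Q -> cong Q P
| C_trans P Q R : cong P Q -> cong Q R -> cong P R
| C_nu x P P' : cong P P' -> cong (nu x P) (nu x P')
| C_par P P' Q Q' : cong P P' -> cong Q Q' -> cong (par P Q) (par P' Q')
| C_out x y P P' : cong P P' -> cong (out x y P) (out x y P')
| C_inp x y P P' : cong P P' -> cong (inp x y P) (inp x y P')
| C_close x P P' : cong P P' -> cong (close x P) (close x P')
| C_wait x P P' : cong P P' -> cong (wait x P) (wait x P')
| C_inl x P P' : cong P P' -> cong (sel_inl x P) (sel_inl x P')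
| C_inr x P P' : cong P P' -> cong (sel_inr x P) (sel_inr x P')
| C_offer x P P' Q Q' :
    cong P P' -> cong Q Q' -> cong (offer x P Q) (offer x P' Q')
| C_link x y : cong (link x y) (link y x)
| C_par0 P : cong (par P inact) P
| C_parC P Q : cong (par P Q) (par Q P)
| C_parA P Q R : cong (par P (par Q R)) (par (par P Q) R)
| C_nuC x y P : cong (nu x (nu y P)) (nu y (nu x P))
| C_scope x P Q : x \notin fn P -> cong (nu x (par P Q)) (par P (nu x Q)).

Inductive red : term -> term -> Prop :=
| R_link w x P : red (nu x (par (link w x) P)) (subst w x P)
| R_tens x y P R :
    red (nu x (par (out x y P) (inp x y R))) (nu x (nu y (par P R)))
| R_one x P Q : red (nu x (par (close x P) (wait x Q))) (par P Q)
| R_plus1 x P Q R :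
    red (nu x (par (sel_inl x P) (offer x Q R))) (nu x (par P Q))
| R_plus2 x P Q R :
    red (nu x (par (sel_inr x P) (offer x Q R))) (nu x (par P R))
| R_nu x P P' : red P P' -> red (nu x P) (nu x P')
| R_par P P' Q : red P P' -> red (par P Q) (par P' Q)
| R_cong P Q Q' P' : cong P Q -> red Q Q' -> cong Q' P' -> red P P'.

Definition is_nu (P : term) : bool := if sval P is RNu _ then true else false.
Definition is_par (P : term) : bool :=
  if sval P is RPar _ _ then true else false.
Definition is_link (P : term) : bool :=
  if sval P is RLink _ _ then true else false.

Definition acts_on (P : term) (x : name) : bool :=
  match sval P with
  | RNil | RNu _ | RPar _ _ => false
  | RLink c d => x \in chan_names c ++ chan_names d
  | ROut c _ | RIn c _ | RClose c _ | RWait c _ | RInl c _ | RInr c _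
  | RCase c _ _ | RAbsurd c => x \in chan_names c
  end.

Definition nus (xs : seq name) (P : term) : term := foldr nu P xs.
Definition pars (Ps : seq term) : term :=
  if Ps is P :: Ps' then foldl par P Ps' else inact.

Definition canonical (P : term) : Prop :=
  exists (n m : nat) (xs : seq name) (Ps : seq term),
    [/\ size xs = n, size Ps = n + m + 1, uniq xs & cong P (nus xs (pars Ps))] /\
    [/\ forall i, i < size Ps ->
          ~~ is_nu (nth inact Ps i) /\ ~~ is_par (nth inact Ps i),
        forall i x, i < size Ps -> x \in xs ->
          ~~ (is_link (nth inact Ps i) && acts_on (nth inact Ps i) x)
      & forall i j x, i < size Ps -> j < size Ps -> i != j -> x \in xs ->
          ~~ (acts_on (nth inact Ps i) x && acts_on (nth inact Ps j) x)].

(* Main.v *)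
(* Every typed process is congruent to a prenex form, a block of restrictions
   over a parallel composition of processes that are neither.  Forgetting how a
   hyper-environment is split into components, the occurrences of a bound
   channel in the types of these processes are exactly one A and one dual A.
   Hence a link acting on a bound channel can be brought next to its cut, and
   two processes acting on the same bound channel have dual heads, while no
   third process mentions the channel: both situations give a redex.  Otherwise
   the prenex form is canonical, once padded with copies of [inact] to have
   more processes than restrictions. *)

Require Import Defs.
From mathcomp Require Import all_boot.
From Stdlib Require List.

Set Implicit Arguments.
Unset Strict Implicit.
Unset Printing Implicit Defensive.

Lemma exists_fresh (s : seq nat) : exists z, z \notin s.
Proof.
exists (foldr maxn 0 s).+1; apply/negP=> zs.
suff: (foldr maxn 0 s).+1 <= foldr maxn 0 s by rewrite ltnn.
elim: s {1 2}(_.+1) zs => //= y s IH z; rewrite inE leq_max.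
by case/orP=> [/eqP-> | /IH->]; rewrite ?leqnn ?orbT.
Qed.

Lemma dualK : involutive dual.
Proof. by elim=> //= A -> B ->. Qed.

Definition open_chan (k : nat) (x : name) (c : chan) : chan :=
  if c is BV i then (if i == k then FV x else c) else c.

Fixpoint open (k : nat) (x : name) (P : raw) : raw :=
  match P with
  | RLink c d => RLink (open_chan k x c) (open_chan k x d)
  | RNil => RNil
  | RNu P => RNu (open k.+1 x P)
  | RPar P Q => RPar (open k x P) (open k x Q)
  | ROut c P => ROut (open_chan k x c) (open k.+1 x P)
  | RIn c P => RIn (open_chan k x c) (open k.+1 x P)
  | RClose c P => RClose (open_chan k x c) (open k x P)
  | RWait c P => RWait (open_chan k x c) (open k x P)
  | RInl c P => RInl (open_chan k x c) (open k x P)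
  | RInr c P => RInr (open_chan k x c) (open k x P)
  | RCase c P Q => RCase (open_chan k x c) (open k x P) (open k x Q)
  | RAbsurd c => RAbsurd (open_chan k x c)
  end.

Lemma openK k x P : x \notin rfn P -> abs k x (open k x P) = P.
Proof.
have H c j : x \notin chan_names c -> abs_chan j x (open_chan j x c) = c.
  case: c => [i _|y] /=; first by case: (i =P j) => [->|] //=; rewrite eqxx.
  by rewrite inE eq_sym => /negbTE->.
elim: P k => [c d|//|P IH|P IHP Q IHQ|c P IH|c P IH|c P IH|c P IH|c P IH|c P IH
             |c P IHP Q IHQ|c] k /=; rewrite ?mem_cat ?negb_or;
  by [move=> ?; rewrite ?H ?IH | case/andP=> *; rewrite ?H ?IH ?IHP ?IHQ
     | case/and3P=> *; rewrite ?H ?IHP ?IHQ].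
Qed.

Lemma lc_open k x P : lc k.+1 P -> lc k (open k x P).
Proof.
have H c j : lc_chan j.+1 c -> lc_chan j (open_chan j x c).
  by case: c => //= i; rewrite ltnS leq_eqVlt; case: eqP.
elim: P k => [c d|//|P IH|P IHP Q IHQ|c P IH|c P IH|c P IH|c P IH|c P IH|c P IH
             |c P IHP Q IHQ|c] k /=;
  by [apply: IH | apply: H
     | case/andP=> *; rewrite ?H ?IH ?IHP ?IHQ
     | case/and3P=> *; rewrite ?H ?IHP ?IHQ].
Qed.

Lemma abs_surj x P : lc 1 P -> x \notin rfn P ->
  exists Q : term, P = abs 0 x (sval Q).
Proof.
by move=> lcP xP; exists (exist (lc 0) _ (lc_open x lcP)); rewrite /= openK.
Qed.

Definition rename (z x y : name) : name := if y == x then z else y.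

Lemma rfn_rsubst z x P : rfn (rsubst z x P) = map (rename z x) (rfn P).
Proof.
have H c : chan_names (rsubst_chan z x c) = map (rename z x) (chan_names c).
  by case: c => //= y; rewrite /rename; case: eqP.
by elim: P => //= *; rewrite ?map_cat ?H; congruence.
Qed.

Lemma rfn_abs k x P : rfn (abs k x P) = [seq y <- rfn P | y != x].
Proof.
have H c j : chan_names (abs_chan j x c) = [seq y <- chan_names c | y != x].
  by case: c => //= y; case: eqP.
elim: P k => [c d|//|P IH|P IHP Q IHQ|c P IH|c P IH|c P IH|c P IH|c P IH|c P IH
             |c P IHP Q IHQ|c] k /=;
  by rewrite ?filter_cat ?H ?IH ?IHP ?IHQ.
Qed.

Lemma rsubst_abs k y z x P : y != x -> y != z ->
  rsubst z x (abs k y P) = abs k y (rsubst z x P).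
Proof.
move=> yx yz.
have H c j : rsubst_chan z x (abs_chan j y c) = abs_chan j y (rsubst_chan z x c).
  case: c => //= u; case: (u =P y) => [->|] /=.
    by rewrite (negbTE yx) /= eqxx.
  by case: (u =P x) => _ uy /=; [rewrite eq_sym (negbTE yz) | case: eqP].
elim: P k => [c d|//|P IH|P IHP Q IHQ|c P IH|c P IH|c P IH|c P IH|c P IH|c P IH
             |c P IHP Q IHQ|c] k /=;
  by rewrite ?H ?IH ?IHP ?IHQ.
Qed.

Lemma names_flatten G : names G = dom (flatten G).
Proof. by rewrite /names /dom map_flatten. Qed.

Lemma dom_cons x A E : dom ((x, A) :: E) = x :: dom E.
Proof. by []. Qed.

Lemma dom_cat E F : dom (E ++ F) = dom E ++ dom F.
Proof. exact: map_cat. Qed.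

Lemma fn_nu x P : fn (nu x P) = [seq y <- fn P | y != x].
Proof. exact: rfn_abs. Qed.

Lemma henv_eqv_flatten G H : henv_eqv G H -> perm_eq (flatten G) (flatten H).
Proof.
case=> K /perm_flatten GK KH; apply: perm_trans GK _.
elim: K H KH => [|Gam K IH] [|Del H] //= /andP[GD KH].
exact: perm_cat GD (IH _ KH).
Qed.

Lemma typed_fn P G : typed P G -> {subset fn P <= names G}.
Proof.
have sub_cons x (s r : seq name) :
    x \in r -> {subset s <= r} -> {subset x :: s <= r}.
  by move=> xr sr u; rewrite inE => /orP[/eqP->|/sr].
have domE := (dom_cons, dom_cat, in_cons, mem_cat).
elim=> {P G}.
- move=> P G H _ IH /henv_eqv_flatten GH u /IH.
  by rewrite !names_flatten (perm_mem (perm_map _ GH)).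
- by move=> x y A _ u.
- move=> P G Gam Del x A _ IH _ _ u; rewrite fn_nu mem_filter.
  case/andP=> /negbTE ux /IH; rewrite !names_flatten /= !domE ux /=.
  by rewrite orbA.
- move=> P Q G H _ IHP _ IHQ u.
  rewrite !names_flatten flatten_cat dom_cat -!names_flatten /fn /= !mem_cat.
  by case/orP=> [/IHP->|/IHQ->]; rewrite ?orbT.
- by [].
- move=> P G Gam Del x y A B _ IH _ _.
  apply: sub_cons => [|u]; first by rewrite mem_head.
  rewrite -/rfn rfn_abs mem_filter => /andP[/negbTE uy /IH].
  by rewrite !names_flatten /= !domE uy /= orbCA -!orbA.
- move=> P G Gam x y A B _ IH _.
  apply: sub_cons => [|u]; first by rewrite mem_head.
  rewrite -/rfn rfn_abs mem_filter => /andP[/negbTE uy /IH].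
  by rewrite !names_flatten /= !domE uy.
- move=> P G x _ IH _.
  apply: sub_cons => [|u /IH]; first by rewrite mem_head.
  by rewrite !names_flatten /= !domE orbC => ->.
- move=> P G Gam x _ IH _ _.
  apply: sub_cons => [|u /IH]; first by rewrite mem_head.
  by rewrite !names_flatten /= !domE => ->; rewrite orbT.
- move=> P G Gam x A B _ IH _.
  by apply: sub_cons => [|u /IH]; first by rewrite mem_head.
- move=> P G Gam x A B _ IH _.
  by apply: sub_cons => [|u /IH]; first by rewrite mem_head.
- move=> P Q Gam x A B _ IHP _ IHQ.
  apply: sub_cons => [|u]; first by rewrite mem_head.
  by rewrite mem_cat => /orP[/IHP|/IHQ].
- by move=> Gam x _; apply: sub_cons => //; rewrite mem_head.
Qed.

Definition occ (x : name) (E : env) : seq ty := [seq p.2 | p <- E & p.1 == x].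

Lemma occ_cat x E F : occ x (E ++ F) = occ x E ++ occ x F.
Proof. by rewrite /occ filter_cat map_cat. Qed.

Lemma occ_cons_eq x A E : occ x ((x, A) :: E) = A :: occ x E.
Proof. by rewrite /occ /= eqxx. Qed.

Lemma occ_nil x E : (occ x E == [::]) = (x \notin dom E).
Proof.
elim: E => // -[y A] E IH; rewrite dom_cons in_cons negb_or -IH eq_sym.
by rewrite /occ /=; case: (x =P y) => [->|/eqP/negbTE]; rewrite ?eqxx // eq_sym => ->.
Qed.

Definition rename_env (z x : name) (E : env) : env :=
  [seq (rename z x p.1, p.2) | p <- E].

Lemma rename_inj z x u v : u != z -> v != z ->
  (rename z x u == rename z x v) = (u == v).
Proof.
rewrite /rename => uz vz; case: (u =P x) => [->|ux]; case: (v =P x) => [->|vx].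
- by rewrite !eqxx.
- by rewrite eq_sym (negbTE vz); apply/esym/eqP=> /esym.
- by rewrite (negbTE uz); apply/esym/eqP.
- by [].
Qed.

Lemma dom_rename z x E : dom (rename_env z x E) = map (rename z x) (dom E).
Proof. by rewrite /dom /rename_env -!map_comp. Qed.

Lemma occ_rename z x y E : z \notin dom E -> y != z ->
  occ (rename z x y) (rename_env z x E) = occ y E.
Proof.
rewrite /occ => zE yz; elim: E zE => //= -[u A] E IH /=.
rewrite inE negb_or eq_sym => /andP[uz zE].
by rewrite rename_inj //; case: eqP => _ /=; rewrite IH.
Qed.

Lemma filter_rename z x xs E : z \notin dom E ->
  [seq p <- rename_env z x E | p.1 \notin z :: xs]
  = [seq p <- E | p.1 \notin x :: xs].
Proof.
elim: E => // -[u A] E IH; rewrite dom_cons in_cons negb_or eq_sym.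
case/andP=> uz /IH {}IH; rewrite /= /rename !in_cons IH.
by case: (u =P x) => _; rewrite ?eqxx /= ?(negbTE uz).
Qed.

Definition head_ok (P : raw) (T : ty) : bool :=
  match P, T with
  | ROut _ _, Tens _ _ | RIn _ _, Parr _ _ | RClose _ _, One | RWait _ _, Bot
  | RInl _ _, Plus _ _ | RInr _ _, Plus _ _ | RCase _ _ _, With _ _
  | RAbsurd _, Top => true
  | _, _ => false
  end.

Definition simple (P : term) : bool := ~~ is_nu P && ~~ is_par P.

(* [E] is the concatenation of the components of a hyper-environment of [P]. *)
Definition uses (P : term) (E : env) : Prop :=
  [/\ simple P, {subset fn P <= dom E}
    & forall x, ~~ is_link P -> acts_on P x ->
        exists2 T, occ x E = [:: T] & head_ok (sval P) T].

Definition uses_pair (q : term * env) : Prop := uses q.1 q.2.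

Lemma acts_on_fn P x : acts_on P x -> x \in fn P.
Proof.
by case: P => [[] //]; rewrite /acts_on /fn /=; intros; rewrite // mem_cat;
  apply/orP; left.
Qed.

Lemma acts_on_subst z x P u :
  acts_on (subst z x P) u -> exists2 v, acts_on P v & u = rename z x v.
Proof.
have H c : u \in chan_names (rsubst_chan z x c) ->
    exists2 v, v \in chan_names c & u = rename z x v.
  case: c => //= y yu; exists y; rewrite ?inE //; move: yu; rewrite /rename.
  by case: eqP => _ /=; rewrite inE => /eqP.
case: P => [[] //= c]; rewrite /acts_on /=; try by move=> *; apply: H.
by move=> d _; rewrite mem_cat => /orP[]/H[v vc ->]; exists v;
  rewrite // mem_cat vc ?orbT.
Qed.

Lemma uses_subst z x P E : z \notin dom E -> uses P E ->
  uses (subst z x P) (rename_env z x E).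
Proof.
move=> zE [simP fnP actP]; split.
- by case: P simP {fnP actP} => [[]].
- move=> u; rewrite /fn /= rfn_rsubst dom_rename => /mapP[v /fnP vE ->].
  exact: map_f.
- move=> u nl /acts_on_subst[v Pv ->].
  have nlP : ~~ is_link P by case: P nl {simP fnP actP Pv} => [[]].
  have [T oT hT] := actP v nlP Pv; exists T.
    rewrite occ_rename //; apply: contraNneq zE => <-.
    exact: fnP (acts_on_fn Pv).
  by case: P hT {simP fnP actP Pv nl nlP oT} => [[]].
Qed.

Definition bigpar (Ps : seq term) : term := foldr par inact Ps.

Lemma pars_bigpar Ps : cong (pars Ps) (bigpar Ps).
Proof.
case: Ps => [|P Ps] /=; first exact: C_refl.
elim: Ps P => [|Q Ps IH] P /=; first exact/C_sym/C_par0.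
by apply: C_trans (IH _) _; apply/C_sym/C_parA.
Qed.

Lemma par0 P : cong (par inact P) P.
Proof. exact: C_trans (C_parC _ _) (C_par0 _). Qed.

Lemma par_congl P P' Q : cong P P' -> cong (par P Q) (par P' Q).
Proof. by move=> h; apply: C_par h (C_refl _). Qed.

Lemma par_congr P Q Q' : cong Q Q' -> cong (par P Q) (par P Q').
Proof. exact: C_par (C_refl _). Qed.

Lemma bigpar_cat Ps Qs : cong (bigpar (Ps ++ Qs)) (par (bigpar Ps) (bigpar Qs)).
Proof.
elim: Ps => [|P Ps IH] /=; first exact/C_sym/par0.
by apply: C_trans (par_congr _ IH) _; apply: C_parA.
Qed.

Lemma bigpar_front Ps P Qs :
  cong (bigpar (Ps ++ P :: Qs)) (par P (bigpar (Ps ++ Qs))).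
Proof.
elim: Ps => [|R Ps IH] /=; first exact: C_refl.
apply: C_trans (par_congr _ IH) _; apply: C_trans (C_parA _ _ _) _.
by apply: C_trans (par_congl _ (C_parC _ _)) _; apply/C_sym/C_parA.
Qed.

Lemma bigpar_pad Ps n : cong (bigpar Ps) (bigpar (Ps ++ nseq n inact)).
Proof.
apply: C_sym; apply: C_trans (bigpar_cat _ _) _.
apply: C_trans (C_par0 _); apply: par_congr.
by elim: n => [|n IH] /=; [apply: C_refl | apply: C_trans (par0 _) IH].
Qed.

Lemma nus_cong xs P Q : cong P Q -> cong (nus xs P) (nus xs Q).
Proof. by move=> PQ; elim: xs => //= x xs IH; apply: C_nu. Qed.

Lemma nus_red xs P Q : red P Q -> red (nus xs P) (nus xs Q).
Proof. by move=> PQ; elim: xs => //= x xs IH; apply: R_nu. Qed.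

Lemma nus_inner xs x P : x \in xs -> cong (nus xs P) (nus (rem x xs) (nu x P)).
Proof.
elim: xs => //= y xs IH; rewrite inE eq_sym.
case: (y =P x) => [-> _|_ /IH h] /=; last exact: C_nu.
elim: xs {IH} => [|u xs IH] /=; first exact: C_refl.
by apply: C_trans (C_nuC _ _ _) _; apply: C_nu.
Qed.

Lemma nus_scope xs P Q : (forall x, x \in xs -> x \notin fn P) ->
  cong (par P (nus xs Q)) (nus xs (par P Q)).
Proof.
elim: xs => [|x xs IH] xP /=; first exact: C_refl.
apply: C_trans (C_sym (C_scope _ (xP x (mem_head _ _)))) _; apply: C_nu.
by apply: IH => y yxs; apply: xP; rewrite inE yxs orbT.
Qed.

Lemma nus_par xs ys P Q : (forall y, y \in ys -> y \notin fn P) ->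
  (forall x, x \in xs -> x \notin fn Q) ->
  cong (par (nus xs P) (nus ys Q)) (nus (xs ++ ys) (par P Q)).
Proof.
move=> yP xQ; rewrite /nus foldr_cat -!/(nus _ _).
have fn_nus zs R : {subset fn (nus zs R) <= fn R}.
  elim: zs => //= z zs IH u; rewrite fn_nu mem_filter.
  by case/andP=> _; apply: IH.
apply: C_trans (C_parC _ _) _.
apply: C_trans (nus_scope _ _) _.
  by move=> x /xQ; apply: contraNN; apply: fn_nus.
apply: nus_cong; apply: C_trans (C_parC _ _) _; exact: nus_scope.
Qed.

Lemma subst_nus z x xs P : x \notin xs -> z \notin xs ->
  subst z x (nus xs P) = nus xs (subst z x P).
Proof.
elim: xs => //= y xs IH; rewrite !inE !negb_or => /andP[xy xxs] /andP[zy zxs].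
rewrite -IH //; apply: val_inj => /=.
by rewrite rsubst_abs // eq_sym.
Qed.

Lemma subst_bigpar z x Ps :
  subst z x (bigpar Ps) = bigpar (map (subst z x) Ps).
Proof.
elim: Ps => [|P Ps IH] /=; first exact: val_inj.
by rewrite -IH; apply: val_inj.
Qed.

Definition bag (s : seq (term * env)) : env := flatten (map snd s).

(* [L] is the list of names that the binders must avoid; it makes the binders of
   the two premises of [T_mix] disjoint. *)
Record prenex (L : seq name) (P : term) (G : henv)
    (xs : seq name) (s : seq (term * env)) : Prop := Prenex {
  prenex_uniq : uniq xs;
  prenex_fresh : forall x, x \in xs -> x \notin L;
  prenex_cong : cong P (nus xs (bigpar (map fst s)));
  prenex_uses : List.Forall uses_pair s;
  prenex_free : perm_eq [seq p <- bag s | p.1 \notin xs] (flatten G);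
  prenex_cut : forall x, x \in xs ->
    exists A, perm_eq (occ x (bag s)) [:: A; dual A] }.

Lemma fn_bag s : List.Forall uses_pair s ->
  {subset fn (bigpar (map fst s)) <= dom (bag s)}.
Proof.
elim=> //= -[P E] {}s [_ /= PE _] _ IH u.
rewrite /bag /dom /= map_cat mem_cat -/(bag s) /fn /= mem_cat.
by case/orP=> [/PE->//|/IH->]; rewrite orbT.
Qed.

Lemma prenex_simple L P T G x Gam : typed P (((x, T) :: Gam) :: G) ->
  simple P -> x \notin names G -> head_ok (sval P) T ->
  (forall u, acts_on P u -> u = x) ->
  exists xs s, prenex L P (((x, T) :: Gam) :: G) xs s.
Proof.
move=> tP sP xG hP aP; exists [::], [:: (P, flatten (((x, T) :: Gam) :: G))].
split=> //=.
- exact/C_sym/C_par0.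
- constructor=> //; split=> //= [u|u _ /aP->].
    by move/(typed_fn tP); rewrite names_flatten.
  exists T => //; rewrite occ_cons_eq occ_cat.
  move: (typed_wf tP) xG => /andP[/andP[xGam _] _].
  by rewrite names_flatten; move: xGam; rewrite -!occ_nil => /eqP-> /eqP->.
- by rewrite /bag /= cats0 filter_predT.
Qed.

Lemma typed_prenex P G : typed P G ->
  forall L, exists xs s, prenex L P G xs s.
Proof.
elim=> {P G}.
- move=> P G H _ IH GH L; have [xs [s [? ? ? ? free ?]]] := IH L.
  by exists xs, s; split=> //; apply: perm_trans free (henv_eqv_flatten GH).
- move=> x y A wf L; exists [::], [:: (link x y, [:: (x, A); (y, dual A)])].
  by split=> //; [apply/C_sym/C_par0 | constructor=> //; split].
- move=> P G Gam Del x A tP IH _ xG L.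
  have [xs [s [uxs fxs congP us free cut]]] := IH (x :: L).
  have xxs : x \notin xs by apply/negP=> /fxs; rewrite mem_head.
  have [z] := exists_fresh (x :: L ++ xs ++ dom (bag s)
    ++ fn (nus xs (bigpar (map fst s)))).
  rewrite in_cons !mem_cat !negb_or => /and5P[zx zL zxs zs zP].
  pose t := [seq (subst z x q.1, rename_env z x q.2) | q <- s].
  have bagt : bag t = rename_env z x (bag s).
    by rewrite /bag /t /rename_env map_flatten -!map_comp.
  exists (z :: xs), t; split.
  + by rewrite /= zxs.
  + move=> u; rewrite inE => /orP[/eqP->//|/fxs].
    by rewrite inE negb_or => /andP[].
  + apply: C_trans (C_nu _ congP) _.
    rewrite -(nu_alpha _ zP) subst_nus // subst_bigpar /t -!map_comp.
    exact: C_refl.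
  + rewrite /t; elim: us zs {free cut congP t bagt zP} => //= -[Q E] s' uQ _ IHs.
    rewrite /bag /dom /= map_cat mem_cat negb_or => /andP[zE zs'].
    by constructor; [apply: uses_subst | apply: IHs].
  + rewrite bagt.
    have -> : [seq p <- rename_env z x (bag s) | p.1 \notin z :: xs]
            = [seq p <- [seq p <- bag s | p.1 \notin xs] | p.1 != x].
      rewrite filter_rename // -filter_predI; apply: eq_filter => p /=.
      by rewrite in_cons negb_or.
    apply: perm_trans (perm_filter _ free) _.
    have /= /andP[/andP[xGam _] /andP[/andP[xDel _] _]] := typed_wf tP.
    have fid E : x \notin dom E -> [seq p <- E | p.1 != x] = E.
      move=> xE; apply/all_filterP/allP=> -[u B] uE /=.
      by apply: contraNneq xE => <-; apply: (map_f fst uE).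
    rewrite /= eqxx /= filter_cat /= eqxx /= filter_cat !fid ?catA //.
    by rewrite -names_flatten.
  + move=> u; rewrite inE bagt; case: (u =P z) => [-> _|/eqP uz /= uxs'].
      exists A; have /= /andP[/andP[xGam _] /andP[/andP[xDel _] _]] := typed_wf tP.
      have -> : occ z (rename_env z x (bag s)) = occ x (bag s).
        by rewrite -{1}(_ : rename z x x = z) ?occ_rename 1?eq_sym // /rename eqxx.
      have -> : occ x (bag s) = occ x [seq p <- bag s | p.1 \notin xs].
        rewrite /occ -filter_predI; congr map; apply: eq_filter => -[v B] /=.
        by case: eqP => //= ->.
      apply: perm_trans (perm_map _ (perm_filter _ free)) _.
      rewrite -/(occ _ _) /= occ_cons_eq occ_cat occ_cons_eq occ_cat.
      move: xGam xDel xG; rewrite names_flatten -!occ_nil.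
      by move=> /eqP-> /eqP-> /eqP->.
    have ux : u != x by apply: contraNneq xxs => <-.
    have [B oB] := cut u uxs'; exists B; rewrite -(occ_rename x zs uz) in oB.
    by move: oB; rewrite /rename (negbTE ux).
- move=> P Q G H _ IHP _ IHQ L.
  have [xs [s [uxs fxs cP us freeP cutP]]] := IHP (L ++ names H).
  have [ys [t [uys fys cQ ut freeQ cutQ]]] := IHQ (L ++ xs ++ dom (bag s)).
  have ysxs y : y \in ys -> y \notin xs.
    by move/fys; rewrite !mem_cat !negb_or => /and3P[].
  have yss y : y \in ys -> y \notin dom (bag s).
    by move/fys; rewrite !mem_cat !negb_or => /and3P[].
  have xst x : x \in xs -> x \notin dom (bag t).
    move=> xxs; apply/negP=> /mapP[[u B] ut' /= xu].
    have: x \notin L ++ names H by apply: fxs.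
    rewrite mem_cat negb_or names_flatten => /andP[_ /negP]; apply.
    rewrite xu -(perm_mem (perm_map _ freeQ)) (map_f fst (x := (u, B))) //.
    rewrite mem_filter ut' andbT /= -xu; apply/negP=> /ysxs.
    by rewrite xxs.
  exists (xs ++ ys), (s ++ t); split.
  + rewrite cat_uniq uxs uys andbT /=; apply/hasPn=> y; exact: ysxs.
  + by move=> u; rewrite mem_cat => /orP[/fxs|/fys]; rewrite mem_cat negb_or => /andP[].
  + apply: C_trans (C_par cP cQ) _; apply: C_trans (nus_par _ _) _.
    * by move=> y /yss; apply: contraNN; apply: fn_bag.
    * by move=> x /xst; apply: contraNN; apply: fn_bag.
    by apply: nus_cong; rewrite map_cat; apply/C_sym/bigpar_cat.
  + exact/List.Forall_app.
  + rewrite /bag map_cat flatten_cat -!/(bag _) filter_cat flatten_cat.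
    apply: perm_cat; [apply: perm_trans freeP|apply: perm_trans freeQ].
      rewrite (eq_in_filter (a2 := fun p => p.1 \notin xs)) // => p ps.
      rewrite mem_cat negb_or; case: (boolP (p.1 \in ys)); rewrite ?andbT //.
      by move=> /yss/negP[]; apply: map_f.
    rewrite (eq_in_filter (a2 := fun p => p.1 \notin ys)) // => p pt.
    rewrite mem_cat negb_or; case: (boolP (p.1 \in xs)) => //.
    by move=> /xst/negP[]; apply: map_f.
  + move=> u; rewrite /bag map_cat flatten_cat -!/(bag _) occ_cat mem_cat.
    case/orP=> [uxs'|uys'].
      by have := xst u uxs'; rewrite -occ_nil => /eqP->; rewrite cats0; apply: cutP.
    by have := yss u uys'; rewrite -occ_nil => /eqP->; apply: cutQ.
- by move=> L; exists [::], [::]; split=> //; apply: C_refl.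
- move=> P G Gam Del x y A B tP _ wf xG L.
  apply: prenex_simple => //; first exact: T_tens.
  by move=> u; rewrite /acts_on /= inE => /eqP.
- move=> P G Gam x y A B tP _ xG L.
  apply: prenex_simple => //; first exact: T_parr.
  by move=> u; rewrite /acts_on /= inE => /eqP.
- move=> P G x tP _ xG L.
  apply: prenex_simple => //; first exact: T_one.
  by move=> u; rewrite /acts_on /= inE => /eqP.
- move=> P G Gam x tP _ wf xG L.
  apply: prenex_simple => //; first exact: T_bot.
  by move=> u; rewrite /acts_on /= inE => /eqP.
- move=> P G Gam x A B tP _ xG L.
  apply: prenex_simple => //; first exact: T_plus1.
  by move=> u; rewrite /acts_on /= inE => /eqP.
- move=> P G Gam x A B tP _ xG L.
  apply: prenex_simple => //; first exact: T_plus2.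
  by move=> u; rewrite /acts_on /= inE => /eqP.
- move=> P Q Gam x A B tP _ tQ _ L.
  apply: prenex_simple => //; first exact: T_with.
  by move=> u; rewrite /acts_on /= inE => /eqP.
- move=> Gam x wf L.
  apply: prenex_simple => //; first exact: T_top.
  by move=> u; rewrite /acts_on /= inE => /eqP.
Qed.

Lemma red_congl P P' Q : cong P P' -> red P' Q -> red P Q.
Proof. by move=> PP' P'Q; apply: R_cong PP' P'Q (C_refl _). Qed.

Lemma nus_redex xs x P P' Q : x \in xs -> cong P P' -> red (nu x P') Q ->
  exists Q', red (nus xs P) Q'.
Proof.
move=> xxs PP' rQ; exists (nus (rem x xs) Q).
apply: red_congl (nus_red _ rQ).
by apply: C_trans (nus_inner _ xxs) _; apply/nus_cong/C_nu.
Qed.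

Lemma red_link x P Q : is_link P -> acts_on P x ->
  exists R, red (nu x (par P Q)) R.
Proof.
case: P => [[] // [] // u [] // v] lcP _; rewrite /acts_on /= !inE.
have -> : exist (lc 0) _ lcP = link u v by apply: val_inj.
case/orP=> /eqP->; last by exists (subst u v Q); apply: R_link.
exists (subst v u Q); apply: red_congl (R_link _ _ _).
exact/C_nu/par_congl/C_link.
Qed.

Definition positive (T : ty) : bool :=
  match T with Tens _ _ | One | Plus _ _ | Zero => true | _ => false end.

Lemma red_dual_positive x P Q T : acts_on P x -> acts_on Q x -> positive T ->
  head_ok (sval P) T -> head_ok (sval Q) (dual T) ->
  exists R, red (nu x (par P Q)) R.
Proof.
case: P Q => [P lcP] [Q lcQ]; rewrite /acts_on /=.
case: T => //= [A B||A B|]; last by case: P lcP.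
- case: P lcP => // -[] // u P lcP; case: Q lcQ => // -[] // v Q lcQ.
  rewrite !inE => /eqP ux /eqP vx _ _ _; rewrite -{}ux -{}vx in lcP lcQ *.
  have [y] := exists_fresh (rfn P ++ rfn Q).
  rewrite mem_cat negb_or => /andP[yP yQ].
  have [P' eP] := abs_surj (x := y) lcP yP.
  have [Q' eQ] := abs_surj (x := y) lcQ yQ.
  exists (nu x (nu y (par P' Q'))).
  have -> : exist (lc 0) (ROut (FV x) P) lcP = out x y P'.
    by apply: val_inj; rewrite /= eP.
  have -> : exist (lc 0) (RIn (FV x) Q) lcQ = inp x y Q'.
    by apply: val_inj; rewrite /= eQ.
  exact: R_tens.
- case: P lcP => // -[] // u P lcP; case: Q lcQ => // -[] // v Q lcQ.
  rewrite !inE => /eqP ux /eqP vx _ _ _; rewrite -{}ux -{}vx in lcP lcQ *.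
  exists (par (exist (lc 0) P lcP) (exist (lc 0) Q lcQ)).
  have -> : exist (lc 0) (RClose (FV x) P) lcP = close x (exist (lc 0) P lcP).
    exact: val_inj.
  have -> : exist (lc 0) (RWait (FV x) Q) lcQ = wait x (exist (lc 0) Q lcQ).
    exact: val_inj.
  exact: R_one.
- case: Q lcQ => // -[] // v Q1 Q2 lcQ.
  have /andP[lcQ1 lcQ2] : lc 0 Q1 && lc 0 Q2 := lcQ.
  have -> : exist (lc 0) (RCase (FV v) Q1 Q2) lcQ =
      offer v (exist (lc 0) Q1 lcQ1) (exist (lc 0) Q2 lcQ2).
    exact: val_inj.
  case: P lcP => // -[] // u P lcP;
    rewrite !inE => /eqP ux /eqP vx _ _ _; rewrite -{}ux -{}vx in lcP lcQ *.
    exists (nu x (par (exist (lc 0) P lcP) (exist (lc 0) Q1 lcQ1))).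
    have -> : exist (lc 0) (RInl (FV x) P) lcP = sel_inl x (exist (lc 0) P lcP).
      exact: val_inj.
    exact: R_plus1.
  exists (nu x (par (exist (lc 0) P lcP) (exist (lc 0) Q2 lcQ2))).
  have -> : exist (lc 0) (RInr (FV x) P) lcP = sel_inr x (exist (lc 0) P lcP).
    exact: val_inj.
  exact: R_plus2.
Qed.

Lemma red_dual x P Q T : acts_on P x -> acts_on Q x ->
  head_ok (sval P) T -> head_ok (sval Q) (dual T) ->
  exists R, red (nu x (par P Q)) R.
Proof.
move=> aP aQ hP hQ; have [posT|negT] := boolP (positive T).
  exact: red_dual_positive hP hQ.
have [||R rR] := @red_dual_positive x Q P (dual T) aQ aP _ hQ.
- by case: T negT {hP hQ}.
- by rewrite dualK.
by exists R; apply: red_congl rR; apply/C_nu/C_parC.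
Qed.

Lemma Forall_nth (T : Type) (p : T -> Prop) x0 s i :
  List.Forall p s -> i < size s -> p (nth x0 s i).
Proof. by move=> ps; elim: ps i => //= x {}s px _ IH [|i] //= /IH. Qed.

Lemma prenex_red_comm L P G xs s i j x : prenex L P G xs s ->
  i < j -> j < size s -> x \in xs ->
  (forall k, ~~ is_link (nth inact (map fst s) k)
             || ~~ acts_on (nth inact (map fst s) k) x) ->
  acts_on (nth inact (map fst s) i) x -> acts_on (nth inact (map fst s) j) x ->
  exists Q, red P Q.
Proof.
case=> _ _ cP us _ cut ij js xxs nolink ai aj.
have is_ := ltn_trans ij js.
have [A oA] := cut x xxs.
set q0 : term * env := (inact, [::]).
have nthE k : k < size s -> nth inact (map fst s) k = (nth q0 s k).1.
  by move=> ks; rewrite (nth_map q0).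
have [T1 o1 h1] : exists2 T, occ x (nth q0 s i).2 = [:: T]
    & head_ok (sval (nth q0 s i).1) T.
  have [_ _ h] := Forall_nth q0 us is_; rewrite -nthE // in h *.
  by apply: h => //; have := nolink i; rewrite ai orbF.
have [T2 o2 h2] : exists2 T, occ x (nth q0 s j).2 = [:: T]
    & head_ok (sval (nth q0 s j).1) T.
  have [_ _ h] := Forall_nth q0 us js; rewrite -nthE // in h *.
  by apply: h => //; have := nolink j; rewrite aj orbF.
rewrite !nthE // in ai aj.
set p1 := nth q0 s i in ai o1 h1; set p2 := nth q0 s j in aj o2 h2.
have [a [b [c es]]] : exists a b c, s = a ++ p1 :: b ++ p2 :: c.
  exists (take i s), (take (j - i.+1) (drop i.+1 s)), (drop j.+1 s).
  rewrite -{1}(cat_take_drop i s) (drop_nth q0) //; congr (_ ++ _ :: _).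
  rewrite -{1}(cat_take_drop (j - i.+1) (drop i.+1 s)) drop_drop subnK //.
  by rewrite (drop_nth q0 js).
clearbody p1 p2; subst s.
pose r := a ++ b ++ c.
have ur : List.Forall uses_pair r.
  case/List.Forall_app: us => ua /List.Forall_cons_iff[_ /List.Forall_app[ub]].
  by case/List.Forall_cons_iff=> _ uc; rewrite !List.Forall_app.
have bagE : perm_eq (occ x (bag (a ++ p1 :: b ++ p2 :: c)))
    (occ x p1.2 ++ occ x p2.2 ++ occ x (bag r)).
  rewrite -!occ_cat; apply/perm_map/perm_filter.
  rewrite /bag /r !map_cat /= !map_cat !flatten_cat /= !flatten_cat /=.
  by rewrite perm_catCA perm_cat2l perm_sym perm_catCA perm_cat2l perm_catCA.
move: oA; rewrite (perm_sym (occ _ _)) => oA.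
have {bagE}oA := perm_trans oA bagE; rewrite {}o1 {}o2 /= in oA.
have r0 : occ x (bag r) = [::].
  by case: (occ x (bag r)) (perm_size oA).
have xr : x \notin fn (bigpar (map fst r)).
  apply/negP=> /(fn_bag ur); apply/negP; by rewrite -occ_nil r0.
have T12 : T2 = dual T1.
  move: oA; rewrite r0; case: (T1 =P A) => [->|TA].
    by rewrite perm_cons => /perm_mem/(_ T2); rewrite !mem_seq1 eqxx => /eqP.
  move=> oA; have := perm_mem oA T1; rewrite !in_cons eqxx (introF eqP TA) orbF /=.
  move/eqP=> eT; move: oA; rewrite -eT (perm_catC [:: A] [:: T1]) perm_cons.
  by move/perm_mem/(_ T2); rewrite !mem_seq1 eqxx eT dualK => /eqP.
rewrite T12 in h2; have [R rR] := red_dual ai aj h1 h2.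
have rc : cong (bigpar (map fst (a ++ p1 :: b ++ p2 :: c)))
    (par (bigpar (map fst r)) (par p1.1 p2.1)).
  rewrite /r !map_cat /= map_cat /=.
  apply: C_trans (bigpar_front _ _ _) _.
  rewrite catA; apply: C_trans (par_congr _ (bigpar_front _ _ _)) _.
  rewrite -catA; apply: C_trans (C_parA _ _ _) _; exact: C_parC.
have [Q rQ] := nus_redex xxs rc
  (red_congl (C_trans (C_scope _ xr) (C_parC _ _)) (R_par _ rR)).
by exists Q; apply: red_congl cP rQ.
Qed.

Lemma prenex_progress L P G xs s : prenex L P G xs s ->
  canonical P \/ exists Q, red P Q.
Proof.
move=> pre; have [uxs _ cP us _ cut] := pre; set Ps := map fst s in cP *.
have nth_s i : nth inact Ps i = inact \/ i < size s.
  by case: (ltnP i (size s)) => [|h]; [right | left; rewrite nth_default // size_map].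
case: (boolP [exists i : 'I_(size s),
    is_link (nth inact Ps i) && has (acts_on (nth inact Ps i)) xs]).
  case/existsP=> i /andP[li /hasP[x xxs ax]]; right.
  have [R rR] := red_link (bigpar (take i Ps ++ drop i.+1 Ps)) li ax.
  have [|Q rQ] := nus_redex (P := bigpar Ps) xxs _ rR.
    rewrite -{1}(cat_take_drop i Ps) (drop_nth inact) ?size_map //.
    exact: bigpar_front.
  by exists Q; apply: red_congl cP rQ.
move=> /existsPn nolink.
have {}nolink x k : x \in xs ->
    ~~ is_link (nth inact Ps k) || ~~ acts_on (nth inact Ps k) x.
  move=> xxs; have [->//|ks] := nth_s k.
  rewrite -negb_and; apply: contraNN (nolink (Ordinal ks)) => /andP[-> ax].
  by apply/hasP; exists x.
case: (boolP [exists i : 'I_(size s), exists j : 'I_(size s), (i != j) &&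
    has (fun x => acts_on (nth inact Ps i) x && acts_on (nth inact Ps j) x) xs]).
  case/existsP=> i /existsP[j /andP[ij /hasP[x xxs /andP[ai aj]]]]; right.
  wlog ltij : i j ij ai aj / i < j => [hw|].
    move: (ij); rewrite -val_eqE /= neq_ltn => /orP[lt|lt]; first exact: hw lt.
    by apply: hw lt => //; rewrite eq_sym.
  by apply: (prenex_red_comm pre ltij _ xxs _ ai aj) => // k; apply: nolink.
move=> /existsPn nocomm; left.
exists (size xs), (size s), xs, (Ps ++ nseq (size xs).+1 inact).
have nthE i : nth inact (Ps ++ nseq (size xs).+1 inact) i = nth inact Ps i.
  rewrite nth_cat nth_nseq if_same; case: ltnP => // h.
  by rewrite nth_default.
split; split=> //.
- by rewrite size_cat size_nseq size_map addnS addn1 addnC.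
- apply: C_trans cP _; apply: nus_cong.
  by apply: C_trans (bigpar_pad _ _) _; apply/C_sym/pars_bigpar.
- move=> i _; rewrite nthE; have [->//|ks] := nth_s i.
  rewrite (nth_map (inact, [::])) //.
  by have [/andP[]] := Forall_nth (inact, [::]) us ks.
- by move=> i x _ xxs; rewrite nthE negb_and nolink.
- move=> i j x _ _ ij xxs; rewrite !nthE.
  have [->//|ki] := nth_s i; have [->|kj] := nth_s j; first by rewrite andbF.
  have /existsPn/(_ (Ordinal kj)) := nocomm (Ordinal ki).
  by rewrite -val_eqE /= ij /= => /hasPn; apply.
Qed.

Theorem theorem25 (P : term) (Gam : env) :
  typed P [:: Gam] -> canonical P \/ exists Q : term, red P Q.
Proof.
by move=> tP; have [xs [s]] := typed_prenex tP [::]; apply: prenex_progress.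
Qed.
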